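(* There exists a universal constant $\beta>0$ such that for every $2<p<\infty$ and every $\phi\in B_{L_p}$, $$\big(\widetilde M_{p\to2}\big)^{-1}\bigg(B_{L_2}\Big(\widetilde M_{p\to2}(\phi),\frac\beta p\Big)\bigg)\subseteq B_{L_p}\Big(\frac1p\phi,\,1-\frac1{4p}\Big).$$
   Context: $L_p$ denotes the real Banach space $L_p([0,1])$ with Lebesgue measure. $B_{\mathbf X}(x,r)$ is the closed ball of radius $r$ centered at $x$ in a Banach space $\mathbf X$, and $B_{\mathbf X}=B_{\mathbf X}(0,1)$. The Mazur map $M_{p\to2}:L_p\to L_2$ is $M_{p\to2}(\phi)(t)=|\phi(t)|^{p/2}\,\mathrm{sign}(\phi(t))$. The normalized Mazur map is $\widetilde M_{p\to2}=M_{p\to2}/\|M_{p\to2}\|$, where $\|M_{p\to2}\|$ denotes the Lipschitz constant of the restriction of $M_{p\to2}$ to the unit ball $B_{L_p}$ (with respect to the $L_p$ and $L_2$ norms), which is finite and less than $p$; $\widetilde M_{p\to2}$ is regarded as a bijection of $L_p$ onto $L_2$, so the preimage is taken in $L_p$. *)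

(* Defs.v *)
From HB Require Import structures.
From mathcomp Require Import all_boot all_order all_algebra.
From mathcomp Require Import interval_inference mathcomp_extra boolp.
From mathcomp Require Import classical_sets functions reals ereal topology.
From mathcomp Require Import normedtype sequences measure ess_sup_inf.
From mathcomp Require Import measurable_realfun lebesgue_measure.
From mathcomp Require Import lebesgue_integral numfun exp hoelder.

Set Implicit Arguments.
Unset Strict Implicit.
Unset Printing Implicit Defensive.
Import Order.TTheory GRing.Theory Num.Theory.
Import numFieldNormedType.Exports.
Local Open Scope classical_set_scope.
Local Open Scope ring_scope.

Section Lnorm_ae.
Context d (T : measurableType d) (R : realType).
Variables (mu : {measure set T -> \bar R}) (p : \bar R).

Lemma Lnorm_ae_eq (f g : T -> R) : (1 <= p)%E ->
  measurable_fun setT f -> measurable_fun setT g -> f = g %[ae mu] ->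
  'N[mu]_p[EFin \o f]%E = 'N[mu]_p[EFin \o g]%E.
Proof.
move=> p1 mf mg fg; rewrite unlock.
case: p p1 => [r _|_|]; last by rewrite leeNy_eq.
  have mpow (h : T -> R) : measurable_fun setT h ->
      measurable_fun [set: T] (fun x => `|(EFin \o h) x| `^ r)%E.
    move=> mh; apply/measurable_EFinP.
    apply: (measurableT_comp (measurable_powR _)) => //.
    exact: measurableT_comp.
  apply: (congr1 (fun z => z `^ r^-1)%E); apply: ge0_ae_eq_integral.
  - exact: measurableT.
  - exact: mpow.
  - exact: mpow.
  - by move=> x _; exact: poweR_ge0.
  - by move=> x _; exact: poweR_ge0.
  by apply: filterS fg => x /(_ I) h _ /=; rewrite h.
case: ifPn => // _; apply: eq_ess_sup.
by apply: filterS fg => x /(_ I) h /=; rewrite h.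
Qed.

End Lnorm_ae.

(* LspaceType mu p1 is the library's type of classes of measurable functions
   modulo mu-a.e. equality with finite L^p norm; it comes without algebraic or
   normed structure, which the next two sections supply. *)
Section Lspace_representatives.
Context d (T : measurableType d) (R : realType).
Variables (mu : {measure set T -> \bar R}) (p : \bar R) (p1 : (1 <= p)%E).
Local Notation Lp := (LspaceType mu p1).
Implicit Types (f g : LfunType mu p1) (u v w : Lp).

Lemma Lspace_Lfun u : (u : T -> R) \in Lfun mu p.
Proof.
apply/andP; split; rewrite inE/=; last exact: Lebesgue_finite.
exact: (@measurable_funPT _ _ _ _ (repr (u : {mfun_ mu, T >-> measurableTypeR R}))).
Qed.

Definition Lrepr u : LfunType mu p1 := Lfun_Sub p1 (Lspace_Lfun u).

(* LfunType uses the default measurable structure on R and LspaceType uses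
   measurableTypeR R: distinct displays, same measurable sets. *)
Lemma Lfun_measurable f :
  @measurable_fun _ _ T (measurableTypeR R) setT (f : T -> R).
Proof. exact: (@measurable_funPT _ _ _ _ (f : {mfun T >-> R})). Qed.

Definition Lmfun f : {mfun T >-> measurableTypeR R} :=
  HB.pack_for {mfun T >-> measurableTypeR R} (f : T -> R)
    (isMeasurableFun.Build _ _ T (measurableTypeR R) _ (Lfun_measurable f)).

Definition Lpi f : {mfun_ mu, T >-> measurableTypeR R} :=
  (\pi_({mfun_ mu, T >-> measurableTypeR R}) (Lmfun f))%qT.

Lemma Lpi_ae f : (Lpi f : T -> R) = f %[ae mu].
Proof. by have /eqmodP/asboolP := reprK (Lpi f). Qed.

Lemma Lpi_finite_norm f : finite_norm mu p (Lpi f).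
Proof.
rewrite /finite_norm (@Lnorm_ae_eq _ _ _ mu p _ f p1 _ _ (Lpi_ae f)).
- exact: Lfunction_finite.
- exact: (@measurable_funPT _ _ _ _ (repr (Lpi f))).
- exact: Lfun_measurable.
Qed.

Definition Lclass f : Lp :=
  HB.pack_for Lp (Lpi f) (isFinLebesgue.Build d T R mu p p1 _ (Lpi_finite_norm f)).

Lemma Lclass_ae f : (Lclass f : T -> R) = f %[ae mu].
Proof. exact: Lpi_ae. Qed.

Lemma LspaceP u v : (u : T -> R) = v %[ae mu] -> u = v.
Proof.
move=> uv.
have E : u = v :> {mfun_ mu, T >-> measurableTypeR R}.
  by rewrite -[LHS]reprK -[RHS]reprK; apply/eqmodP/asboolP.
case: u v E {uv} => [u [[u']]] [v [[v']]] /= E; subst v.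
by rewrite (Prop_irrelevance u' v').
Qed.

Lemma LclassK : cancel (@Lrepr) Lclass.
Proof. by move=> u; apply: LspaceP; exact: Lclass_ae. Qed.

End Lspace_representatives.

(* Each operation on classes is the pointwise operation on representatives, and
   the norm of a class is the Lnorm of any representative. *)
Section Lspace_normed_module.
Context d (T : measurableType d) (R : realType).
Variables (mu : {measure set T -> \bar R}) (p : \bar R) (p1 : (1 <= p)%E).
Local Notation Lp := (LspaceType mu p1).
Implicit Types (f g : LfunType mu p1) (u v w : Lp) (a b : R).

Lemma eq_Lclass f g : (f : T -> R) = g %[ae mu] -> Lclass f = Lclass g.
Proof.
move=> fg; apply: LspaceP; apply: (ae_eq_trans (Lclass_ae f)).
exact: (ae_eq_trans fg (ae_eq_sym (Lclass_ae g))).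
Qed.

HB.instance Definition _ := gen_eqMixin Lp.
HB.instance Definition _ := gen_choiceMixin Lp.

Definition Ladd u v : Lp := Lclass (Lrepr u + Lrepr v).
Definition Lopp u : Lp := Lclass (- Lrepr u).
Definition Lscale a u : Lp := Lclass (a *: Lrepr u).

Lemma LclassD f g : Lclass (f + g) = Ladd (Lclass f) (Lclass g).
Proof.
apply: eq_Lclass; move: (Lclass_ae f) (Lclass_ae g); apply: filterS2.
by move=> x hf hg _; exact: (congr2 +%R (esym (hf I)) (esym (hg I))).
Qed.

Lemma LclassN f : Lclass (- f) = Lopp (Lclass f).
Proof.
apply: eq_Lclass; move: (Lclass_ae f); apply: filterS => x hf _.
exact: (congr1 -%R (esym (hf I))).
Qed.

Lemma LclassZ a f : Lclass (a *: f) = Lscale a (Lclass f).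
Proof.
apply: eq_Lclass; move: (Lclass_ae f); apply: filterS => x hf _.
exact: (congr1 ( *%R a) (esym (hf I))).
Qed.

Let LaddA : associative Ladd.
Proof.
by move=> u v w; rewrite -[u]LclassK -[v]LclassK -[w]LclassK -!LclassD addrA.
Qed.

Let LaddC : commutative Ladd.
Proof. by move=> u v; rewrite /Ladd addrC. Qed.

Let Ladd0 : left_id (Lclass 0) Ladd.
Proof. by move=> u; rewrite -[u]LclassK -LclassD add0r. Qed.

Let LaddN : left_inverse (Lclass 0) Lopp Ladd.
Proof. by move=> u; rewrite -[u]LclassK -LclassN -LclassD addNr. Qed.

HB.instance Definition _ := GRing.isZmodule.Build Lp LaddA LaddC Ladd0 LaddN.

Let LscaleA a b u : Lscale a (Lscale b u) = Lscale (a * b) u.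
Proof. by rewrite -[u]LclassK -!LclassZ scalerA. Qed.

Let Lscale1 : left_id 1 Lscale.
Proof. by move=> u; rewrite -[u]LclassK -LclassZ scale1r. Qed.

Let LscaleDr : right_distributive Lscale +%R.
Proof.
move=> a u v; rewrite -[u]LclassK -[v]LclassK.
by rewrite -[LHS]/(Lscale a (Ladd _ _)) -LclassD -!LclassZ scalerDr LclassD.
Qed.

Let LscaleDl u : {morph Lscale^~ u : a b / a + b >-> a + b}.
Proof. by move=> a b; rewrite /= -[u]LclassK -!LclassZ scalerDl LclassD. Qed.

HB.instance Definition _ :=
  GRing.Zmodule_isLmodule.Build R Lp LscaleA Lscale1 LscaleDr LscaleDl.

Definition Lspace_norm u : R := fine 'N[mu]_p[EFin \o (u : T -> R)]%E.

Lemma Lspace_normE f : Lspace_norm (Lclass f) = fine 'N[mu]_p[EFin \o f]%E.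
Proof.
congr fine; apply: (Lnorm_ae_eq p1 _ _ (Lclass_ae f)).
- exact: (Lfun_measurable (Lrepr (Lclass f))).
- exact: Lfun_measurable.
Qed.

Let ler_Lspace_normD u v :
  Lspace_norm (u + v) <= Lspace_norm u + Lspace_norm v.
Proof.
rewrite -[u]LclassK -[v]LclassK -[_ + _]/(Ladd _ _) -LclassD !Lspace_normE.
exact: ler_LnormD.
Qed.

Let Lspace_normZ a u : Lspace_norm (a *: u) = `|a| * Lspace_norm u.
Proof.
rewrite -[u]LclassK -[_ *: _]/(Lscale _ _) -LclassZ !Lspace_normE.
by apply: EFin_inj; rewrite EFinM !finite_norm_fine; exact: LnormZ.
Qed.

Let Lspace_norm0_eq0 u : Lspace_norm u = 0 -> u = 0.
Proof.
rewrite -[u]LclassK Lspace_normE => /fine_Lnormr_eq0 u0.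
exact: eq_Lclass.
Qed.

HB.instance Definition _ := Lmodule_isNormed.Build R Lp
  ler_Lspace_normD Lspace_normZ Lspace_norm0_eq0.

End Lspace_normed_module.

Section Mazur_function.
Context d (T : measurableType d) (R : realType).
Variable mu : {measure set T -> \bar R}.

Definition mazur_fun (p : R) (f : T -> R) : T -> R :=
  fun t => `|f t| `^ (p / 2) * Num.sg (f t).

Lemma mazur_fun_Lfun (p : R) (f : T -> R) : 1 <= p ->
  f \in Lfun mu p%:E -> mazur_fun p f \in Lfun mu 2%:E.
Proof.
move=> p1 fp; have p0 : 0 < p := lt_le_trans ltr01 p1.
have /andP[/[!inE]/= mf _] := fp.
apply/andP; split; rewrite inE/=.
  apply: measurable_funM.
    apply: (measurableT_comp (measurable_powR _)).
    exact: measurableT_comp.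
  apply: measurableT_comp mf; apply: nondecreasing_measurable => // x y xy.
  case: (sgrP x) => hx; case: (sgrP y) => hy //; rewrite ?lexx ?ler01 ?lerN10//.
  - by have := le_lt_trans xy hy; rewrite hx ltxx.
  - by have := lt_le_trans hx xy; rewrite hy ltxx.
  - by have := lt_trans (lt_le_trans hx xy) hy; rewrite ltxx.
have /integrableP[_] := Lfun_integrable p1 fp.
rewrite /finite_norm Lnorm.unlock => fin.
apply: poweR_lty; apply: le_lt_trans fin.
rewrite le_eqVlt; apply/orP; left; apply/eqP; apply: eq_integral => t _ /=.
congr EFin.
rewrite /mazur_fun normrM !(ger0_norm (powR_ge0 _ _)).
have [->|ft0] := eqVneq (f t) 0.
  by rewrite sgr0 normr0 mulr0 !powR0// gt_eqF.
by rewrite normr_sg ft0 mulr1 -powRrM divfK.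
Qed.

End Mazur_function.

(* Lebesgue measure restricted to [0, 1], as a measure on the whole line: its
   a.e. classes of functions on R are the a.e. classes of functions on [0, 1]. *)
Definition leb01 (R : realType) : {measure set (measurableTypeR R) -> \bar R} :=
  mrestr (@lebesgue_measure R) (measurable_itv `[0, 1]%R).

Definition Lp (R : realType) (p : R) (p1 : 1 <= p) :=
  LspaceType (leb01 R) (p1 : (1 <= p%:E)%E).

HB.instance Definition _ (R : realType) (p : R) (p1 : 1 <= p) :=
  NormedModule.on (Lp p1).

Definition mazur (R : realType) (p : R) (p1 : 1 <= p) (phi : Lp p1) :
    Lp (ler1n R 2) :=
  Lclass (Lfun_Sub (ler1n R 2 : (1 <= 2%:E)%E)
    (mazur_fun_Lfun p1 (Lspace_Lfun phi))).

Lemma mazurE (R : realType) (p : R) (p1 : 1 <= p) (phi : Lp p1) :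
  (mazur phi : R -> R) = mazur_fun p (phi : R -> R) %[ae leb01 R].
Proof. exact: Lclass_ae. Qed.

(* The least Lipschitz constant of f on A, when f is Lipschitz on A; as inf set0
   is 0, the value is 0 when f is not Lipschitz on A. *)
Definition lipschitz_constant (R : realType) (V W : normedModType R)
    (A : set V) (f : V -> W) : R :=
  inf [set k : R | 0 <= k /\ k.-lipschitz_A f].

Definition normalized_mazur (R : realType) (p : R) (p1 : 1 <= p) (phi : Lp p1) :
    Lp (ler1n R 2) :=
  (lipschitz_constant (closed_ball_ Num.norm 0 1) (@mazur R p p1))^-1 *: mazur phi.

Lemma gt2_ge1 (R : realType) (p : R) : 2 < p -> 1 <= p.
Proof. by move=> /ltW; apply: le_trans; rewrite ler1n. Qed.

(* Main.v *)
Require Import Defs.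
From mathcomp Require Import all_boot all_order all_algebra.
From mathcomp Require Import boolp classical_sets functions reals topology.
From mathcomp Require Import normedtype measure lebesgue_measure hoelder.
From mathcomp Require Import ereal sequences exp measurable_realfun.
From mathcomp Require Import lebesgue_integral ring lra.
Import Order.TTheory GRing.Theory Num.Theory.
Import numFieldNormedType.Exports.
Local Open Scope classical_set_scope.
Local Open Scope ring_scope.
Set Implicit Arguments.
Unset Strict Implicit.
Unset Printing Implicit Defensive.

(** Write [M] for the Mazur map from [L_p] to [L_2], which applies the signed
power [x |-> |x| ^ (p/2) * sg x] pointwise, and [L] for its Lipschitz constant
on the unit ball.

First, [1 <= L <= p].  The constant function 1 gives the lower bound.  For the
upper bound, the signed power satisfies
[|M x - M y| <= p/2 * m ^ (p/2 - 1) * |x - y|] with [m = max |x| |y|].  Given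
[u] and [v] in the unit ball at distance [D > 0], this is squared and integrated
after [m ^ (p - 2) * (|u - v| / D) ^ 2] is bounded by
[|u| ^ p + |v| ^ p + (|u - v| / D) ^ p], whose integral is at most 3
([Lspace_mazur_dist_le]).  The bound on [L] turns a distance [beta / p] between
normalized images into a distance at most [beta] between the images under [M].

Second, suppose [||M u - M v||_2 <= b] with [||u||_p <= 1]; the quantity to
bound is the integral of [|v - u / p| ^ p].  Where [u] and [v] have the same sign and
are within a factor 2 of each other, [|v - u / p| <= (1 - 1 / (2 p)) * |v|], and
[(1 - 1 / (2 p)) ^ p <= exp (- 1/2) <= 2/3].  Elsewhere
[max |u| |v| ^ p <= 4 * |M u - M v| ^ 2], and [(1 + 1/p) ^ p <= 4].  Hence the
integral is at most [2/3 * ||v|| ^ p + 16 * b ^ 2] ([Lspace_dist_scale_le]), and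
[||v|| ^ p = ||M v|| ^ 2 <= (1 + b) ^ 2].  For [b = 1/100] the sum is below
[5/7 <= (1 - 1 / (4 p)) ^ p]. *)

(** * The signed power *)

Section signed_power.
Context {R : realType}.
Implicit Types (x y m D p q : R).

(** The scalar function that the Mazur map applies pointwise, for [q = p / 2].
Its value at 0 is 0 for every [q], because the sign of 0 is 0. *)
Definition spow q x : R := `|x| `^ q * Num.sg x.

Lemma spowN q x : spow q (- x) = - spow q x.
Proof. by rewrite /spow normrN sgrN mulrN. Qed.

Lemma ge0_spow q x : q != 0 -> 0 <= x -> spow q x = x `^ q.
Proof.
move=> q0; rewrite /spow le_eqVlt => /predU1P[<-|x0].
  by rewrite sgr0 mulr0 powR0.
by rewrite gtr0_sg// mulr1 gtr0_norm.
Qed.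

Lemma normr_spow q x : q != 0 -> `|spow q x| = `|x| `^ q.
Proof.
move=> q0; rewrite /spow normrM normr_sg ger0_norm ?powR_ge0//.
by have [->|] := eqVneq x 0; rewrite ?mulr1// mulr0 normr0 powR0.
Qed.

Lemma sqr_normr_spow p x : p != 0 -> `|spow (p / 2) x| ^+ 2 = `|x| `^ p.
Proof.
move=> p0; rewrite normr_spow ?mulf_neq0 ?invr_eq0 ?pnatr_eq0//.
by rewrite -powR_mulrn ?powR_ge0// -powRrM divfK ?pnatr_eq0.
Qed.

(** The tangent line inequality for the convex function [x `^ q], obtained from
Young's inequality applied to [y * x `^ (q - 1)]. *)
Lemma powRB_le x y q : 1 < q -> 0 <= x -> 0 <= y ->
  x `^ q - y `^ q <= q * x `^ (q - 1) * (x - y).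
Proof.
move=> q1 x0 y0; have q0 : 0 < q by rewrite (lt_trans ltr01).
have q'0 : 0 < q - 1 by rewrite subr_gt0.
have := @conjugate_powR R y (x `^ (q - 1)) q (q / (q - 1)) y0 (powR_ge0 _ _) q0.
rewrite divr_gt0// => /(_ isT).
have -> : q^-1 + (q / (q - 1))^-1 = 1 by field; rewrite !gt_eqF.
move=> /(_ erefl); rewrite -powRrM [_ * (q / _)]mulrC divfK ?gt_eqF//.
rewrite -(ler_pM2l q0).
have -> : q * (y `^ q / q + x `^ q / (q / (q - 1))) = y `^ q + (q - 1) * x `^ q.
  by field; rewrite !gt_eqF.
rewrite -(mulr_powRB1 x0 q0); lra.
Qed.

Lemma spow_lipschitz x y m q : 1 < q -> `|x| <= m -> `|y| <= m ->
  `|spow q x - spow q y| <= q * m `^ (q - 1) * `|x - y|.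
Proof.
move=> q1; have q0 : q != 0 by rewrite gt_eqF// (lt_trans ltr01).
have q'0 : 0 <= q - 1 by rewrite subr_ge0 ltW.
wlog yx : x y / y <= x => [H xm ym|xm ym].
  have [yx|/ltW xy] := leP y x; first by apply: H.
  by rewrite distrC (distrC x); exact: H.
have m0 : 0 <= m by rewrite (le_trans (normr_ge0 x)).
have mono z : 0 <= z -> z <= m -> z `^ (q - 1) <= m `^ (q - 1).
  by move=> z0 zm; apply: ge0_ler_powR; rewrite // nnegrE.
have pos u v : 0 <= v -> v <= u -> u <= m ->
    `|spow q u - spow q v| <= q * m `^ (q - 1) * `|u - v|.
  move=> v0 vu um; have u0 := le_trans v0 vu.
  rewrite !ge0_spow// (ger0_norm (_ : 0 <= u - v)) ?subr_ge0//.
  rewrite ger0_norm; last first.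
    by rewrite subr_ge0 ge0_ler_powR ?nnegrE// (le_trans _ (ltW q1)).
  apply: le_trans (powRB_le q1 u0 v0) _.
  rewrite ler_wpM2r ?subr_ge0// ler_wpM2l ?mono//.
  by rewrite (le_trans _ (ltW q1)).
(* When [x] and [y] have the same sign the bound reduces to [pos]; when they
   have opposite signs, [|x - y| = |x| + |y|] and the factor [q] is not needed. *)
have [y0|/ltW y0] := leP 0 y.
  by apply: pos => //; rewrite (le_trans (ler_norm _)).
have [x0|/ltW x0] := leP 0 x; last first.
  have -> : spow q x - spow q y = spow q (- y) - spow q (- x).
    by rewrite !spowN; ring.
  have -> : x - y = - y - - x by ring.
  by apply: pos; rewrite ?oppr_ge0 ?lerN2// -(ler0_norm y0).
have y0' : 0 <= - y by rewrite oppr_ge0.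
have -> : spow q y = - spow q (- y) by rewrite spowN opprK.
rewrite !ge0_spow// opprK ger0_norm ?addr_ge0 ?powR_ge0//.
rewrite (ger0_norm (_ : 0 <= x - y)) ?subr_ge0//.
have q_gt0 : 0 < q by rewrite (lt_trans ltr01).
rewrite -[in leLHS](mulr_powRB1 x0)// -[in leLHS](mulr_powRB1 y0')//.
move: xm ym; rewrite (ger0_norm x0) (ler0_norm y0) =>
  /(mono _ x0) hx /(mono _ y0') hy.
have := powR_ge0 m (q - 1).
have hx' := ler_wpM2l x0 hx; have hy' := ler_wpM2l y0' hy => M0.
apply: (le_trans (lerD hx' hy')); rewrite -mulrDl [leLHS]mulrC -mulrA.
by rewrite ler_peMl ?mulr_ge0 ?addr_ge0// ltW.
Qed.

(** With [m = max |x| |y|] and [d = |x - y| / D], the three terms come from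
[m `^ (p - 2) * d ^+ 2 <= max m d `^ p]. *)
Lemma sqr_spow_dist_le p x y D : 2 < p -> 0 < D ->
  `|spow (p / 2) x - spow (p / 2) y| ^+ 2 <=
  (p / 2 * D) ^+ 2 * (`|x| `^ p + `|y| `^ p + D^-1 `^ p * `|x - y| `^ p).
Proof.
move=> p2 D0; have p0 : 0 < p by rewrite (lt_trans _ p2).
set m := Num.max `|x| `|y|; set d := D^-1 * `|x - y|.
have m0 : 0 <= m by rewrite le_max normr_ge0.
have d0 : 0 <= d by rewrite mulr_ge0// invr_ge0 ltW.
have q1 : 1 < p / 2 by lra.
have H := @spow_lipschitz x y m _ q1.
have {}H : `|spow (p / 2) x - spow (p / 2) y| <=
    p / 2 * m `^ (p / 2 - 1) * `|x - y|.
  by apply: H; rewrite le_max lexx ?orbT.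
have -> : D^-1 `^ p * `|x - y| `^ p = d `^ p.
  by rewrite powRM// invr_ge0 ltW.
rewrite -ler_sqr ?nnegrE// in H; last first.
  by rewrite !mulr_ge0 ?powR_ge0// ltW// (lt_trans ltr01).
apply: (le_trans H).
have -> : p / 2 * m `^ (p / 2 - 1) * `|x - y| =
          p / 2 * D * (m `^ (p / 2 - 1) * d).
  by rewrite /d; field; rewrite gt_eqF.
rewrite exprMn ler_wpM2l ?sqr_ge0// exprMn.
rewrite -powR_mulrn ?powR_ge0// -powRrM.
have -> : (p / 2 - 1) * 2%:R = p - 2 by field.
pose M := Num.max m d.
have M0 : 0 <= M by rewrite le_max m0.
have mM : m <= M by rewrite le_max lexx.
have dM : d <= M by rewrite le_max lexx orbT.
apply: (@le_trans _ _ (M `^ p)).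
  have -> : M `^ p = M `^ (p - 2) * M ^+ 2.
    rewrite -powR_mulrn// -powRD ?subrK//.
    by apply/implyP; rewrite gt_eqF.
  apply: ler_pM; rewrite ?powR_ge0 ?sqr_ge0//.
    by rewrite ge0_ler_powR ?nnegrE// subr_ge0 ltW.
  by rewrite ler_sqr ?nnegrE.
have := powR_ge0 `|x| p; have := powR_ge0 `|y| p; have := powR_ge0 d p.
by rewrite /M /m; case: (leP _ d); case: (leP `|x| `|y|); lra.
Qed.

Lemma powR_half x y q : 1 <= q -> 0 <= x -> 2 * x <= y -> 2 * x `^ q <= y `^ q.
Proof.
move=> q1 x0 xy; have q0 : 0 <= q by rewrite (le_trans _ q1).
apply: (@le_trans _ _ ((2 * x) `^ q)).
  by rewrite powRM// ler_wpM2r ?powR_ge0// le1r_powR// ler1n.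
by apply: ge0_ler_powR; rewrite ?nnegrE// ?(le_trans _ xy)// mulr_ge0.
Qed.

(** If [x] and [y] are not comparable (opposite signs, or moduli differing by a
factor more than 2), the signed power separates them. *)
Lemma max_le_spow_dist p x y : 2 <= p ->
  ~~ [&& 0 <= x * y, `|y| <= 2 * `|x| & `|x| <= 2 * `|y|] ->
  Num.max `|x| `|y| `^ p <= 4 * `|spow (p / 2) x - spow (p / 2) y| ^+ 2.
Proof.
move=> p2; have p0 : p != 0 by rewrite gt_eqF// (lt_le_trans _ p2).
have q1 : 1 <= p / 2 by lra.
have q0 : p / 2 != 0 by rewrite gt_eqF// (lt_le_trans _ q1).
wlog xy : x y / `|x| <= `|y| => [H|].
  case/orP: (le_total `|x| `|y|) => [/H//|yx nc].
  rewrite maxC distrC; apply: H => //.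
  by rewrite mulrC [X in ~~ (_ && X)]andbC.
rewrite (max_idPr xy) -(sqr_normr_spow _ p0).
set u := spow _ x; set v := spow _ y.
have [xy0 /=|xy0 _] := leP 0 (x * y).
  have -> : `|x| <= 2 * `|y| by have := normr_ge0 y; lra.
  rewrite andbT -ltNge => /ltW yx.
  have uv : 2 * `|u| <= `|v| by rewrite !normr_spow// powR_half.
  have := lerB_dist v u; rewrite (distrC v) => h.
  have -> : 4 * `|u - v| ^+ 2 = (2 * `|u - v|) ^+ 2 by ring.
  by rewrite ler_sqr ?nnegrE ?mulr_ge0//; lra.
have uv : u * v <= 0.
  by rewrite /u /v /spow mulrACA -sgrM ltr0_sg.
rewrite !real_normK ?num_real//; have := sqr_ge0 u; have := sqr_ge0 (u - v); nra.
Qed.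

Lemma normrB_scale_close p x y : 2 <= p ->
  [&& 0 <= x * y, `|y| <= 2 * `|x| & `|x| <= 2 * `|y|] ->
  `|y - p^-1 * x| <= (1 - (2 * p)^-1) * `|y|.
Proof.
move=> p2 /and3P[xy yx xy2]; have p0 : 0 < p by rewrite (lt_le_trans _ p2).
have pV : p^-1 <= 2^-1 by rewrite lef_pV2// posrE.
have pV0 : 0 < p^-1 by rewrite invr_gt0.
have -> : (2 * p)^-1 = p^-1 / 2 by rewrite invfM mulrC.
set c := p^-1 in pV pV0 *.
have key a b : 0 <= a -> 0 <= b -> b <= 2 * a -> a <= 2 * b ->
    `|b - c * a| <= (1 - c / 2) * b.
  by move=> a0 b0 ba ab; rewrite ler_norml; apply/andP; split; nra.
have [x0|x0] := leP 0 x; have [y0|y0] := leP 0 y.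
- by move: yx xy2; rewrite (ger0_norm x0) (ger0_norm y0); exact: key.
- move: yx xy2; rewrite (ger0_norm x0) !(ltr0_norm y0) => yx xy2; nra.
- move: yx xy2; rewrite (ltr0_norm x0) !(ger0_norm y0) => yx xy2; nra.
- move: yx xy2; rewrite (ltr0_norm x0) !(ltr0_norm y0) => yx xy2.
  have -> : y - c * x = - (- y - c * - x) by ring.
  by rewrite normrN; apply: key => //; rewrite oppr_ge0 ltW.
Qed.

Lemma expR_powR x p : expR x `^ p = expR (p * x).
Proof. by rewrite mulrC expRM. Qed.

Lemma powR_shrink_le p : 1 <= p -> (1 - (2 * p)^-1) `^ p <= 2 / 3.
Proof.
move=> p1; have p0 : 0 < p by rewrite (lt_le_trans _ p1).
have h : 0 <= 1 - (2 * p)^-1 by rewrite subr_ge0 invf_le1; lra.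
have : (1 - (2 * p)^-1) `^ p <= expR (- (2 * p)^-1) `^ p.
  by apply: ge0_ler_powR; rewrite ?nnegrE ?expR_ge0 ?expR_ge1Dx// ltW.
rewrite expR_powR.
have -> : p * - (2 * p)^-1 = - 2^-1 by field; rewrite gt_eqF.
move=> /le_trans; apply; rewrite expRN -invf_div lef_pV2 ?posrE ?expR_gt0//.
by have := expR_ge1Dx (2^-1 : R); lra.
Qed.

Lemma powR_grow_le p : 0 < p -> (1 + p^-1) `^ p <= 4.
Proof.
move=> p0; have : (1 + p^-1) `^ p <= expR p^-1 `^ p.
  apply: ge0_ler_powR; rewrite ?nnegrE ?expR_ge0 ?expR_ge1Dx// ltW//.
  by rewrite addr_gt0 ?invr_gt0.
rewrite expR_powR divff ?gt_eqF// => /le_trans; apply.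
have -> : 1 = 2^-1 + 2^-1 :> R by field.
rewrite expRD -[2^-1]opprK expRN.
have h := expR_ge1Dx (- 2^-1 : R).
have : (expR (- 2^-1))^-1 <= 2 :> R by rewrite invf_ple ?posrE ?expR_gt0//; lra.
have : 0 <= (expR (- 2^-1))^-1 :> R by rewrite invr_ge0 expR_ge0.
nra.
Qed.

(** [(1 - (4 * p)^-1)^-1 = 1 + s <= expR s] with [s = (4 * p - 1)^-1], and
[p * s <= 2 / 7]. *)
Lemma powR_shrink_ge p : 2 <= p -> 5 / 7 <= (1 - (4 * p)^-1) `^ p.
Proof.
move=> p2; have p0 : 0 < p by rewrite (lt_le_trans _ p2).
set s := (4 * p - 1)^-1; have d0 : 0 < 4 * p - 1 by lra.
have s1 : expR (- s) <= 1 - (4 * p)^-1.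
  have -> : 1 - (4 * p)^-1 = (1 + s)^-1.
    by rewrite /s; field; rewrite !gt_eqF//; lra.
  by rewrite expRN lef_pV2 ?expR_ge1Dx// posrE ?expR_gt0// addr_gt0 ?invr_gt0.
have : expR (- s) `^ p <= (1 - (4 * p)^-1) `^ p.
  apply: ge0_ler_powR => //; rewrite ?nnegrE ?expR_ge0 ?(ltW p0)//.
  exact: le_trans (expR_ge0 _) s1.
apply: le_trans; rewrite expR_powR; apply: le_trans (expR_ge1Dx _).
have : p * s <= 2 / 7 by rewrite /s ler_pdivrMr//; lra.
lra.
Qed.

(** The first term bounds the comparable pairs (same sign, moduli within a
factor 2 of each other), the second term all the others. *)
Lemma powR_dist_scale_le p x y : 2 <= p ->
  `|y - p^-1 * x| `^ p <=
    2 / 3 * `|y| `^ p + 16 * `|spow (p / 2) y - spow (p / 2) x| ^+ 2.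
Proof.
move=> p2; have p0 : 0 < p by rewrite (lt_le_trans _ p2).
have pV0 : 0 < p^-1 by rewrite invr_gt0.
have [cl|far] := boolP [&& 0 <= x * y, `|y| <= 2 * `|x| & `|x| <= 2 * `|y|].
  have h := normrB_scale_close p2 cl.
  have h0 : 0 <= 1 - (2 * p)^-1 by rewrite subr_ge0 invf_le1; lra.
  apply: (@le_trans _ _ (((1 - (2 * p)^-1) * `|y|) `^ p)).
    by apply: ge0_ler_powR; rewrite ?nnegrE ?mulr_ge0// ltW.
  rewrite powRM//; have := powR_shrink_le (le_trans (ler1n R 2) p2).
  have := powR_ge0 `|y| p.
  have := sqr_ge0 `|spow (p / 2) y - spow (p / 2) x|; nra.
have := max_le_spow_dist p2 far; set m := Num.max _ _ => hm.
have m0 : 0 <= m by rewrite le_max normr_ge0.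
have : `|y - p^-1 * x| <= (1 + p^-1) * m.
  apply: le_trans (ler_normB _ _) _; rewrite normrM (gtr0_norm pV0) mulrDl mul1r.
  by rewrite lerD ?ler_wpM2l ?(ltW pV0)// le_max lexx ?orbT.
have g0 : 0 <= 1 + p^-1 by rewrite ltW// addr_gt0.
move=> /(ge0_ler_powR (ltW p0)) => /(_ _ _)/le_trans; apply;
  rewrite ?nnegrE ?mulr_ge0//.
rewrite powRM//; have := powR_grow_le p0; have := powR_ge0 `|y| p.
move: hm; rewrite distrC; have := powR_ge0 m p; nra.
Qed.

End signed_power.

(** * Pointwise estimates integrated over a measure space *)

Section Lspace_norm.
Context d (T : measurableType d) (R : realType) (mu : {measure set T -> \bar R}).

Section one_exponent.
Context (p : R) (p1 : (1 <= p%:E)%E).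
Implicit Types (u v : LspaceType mu p1) (a : R).

Lemma integral_Lspace_norm u : (\int[mu]_x (`|u x| `^ p)%:E = (`|u| `^ p)%:E)%E.
Proof.
have p0 : p != 0 by rewrite gt_eqF// (lt_le_trans ltr01).
have -> : `|u| = fine 'N[mu]_p%:E[EFin \o (u : T -> R)]%E by [].
by rewrite -poweR_EFin (finite_norm_fine (Lrepr u)) powR_Lnorm.
Qed.

Lemma LspaceB_ae u v : {ae mu, forall x, (u - v) x = u x - v x}.
Proof.
have h1 : ((u - v : LspaceType mu p1) : T -> R) = Lrepr u + Lrepr (- v) %[ae mu].
  exact: Lclass_ae.
have h2 : ((- v : LspaceType mu p1) : T -> R) = - Lrepr v %[ae mu].
  exact: Lclass_ae.
by apply: filterS2 h1 h2 => x /(_ I) -> /(_ I) /= h; rewrite -[X in _ = _ + X]h.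
Qed.

Lemma LspaceZ_ae a u : {ae mu, forall x, (a *: u) x = a * u x}.
Proof.
have h : ((a *: u : LspaceType mu p1) : T -> R) = a *: Lrepr u %[ae mu].
  exact: Lclass_ae.
by apply: filterS h => x /(_ I) ->.
Qed.

Lemma measurable_Lspace_powR u :
  measurable_fun [set: T] (fun x => (`|u x| `^ p)%:E).
Proof.
apply/measurable_EFinP; apply: (measurableT_comp (measurable_powR _)) => //.
exact: measurableT_comp.
Qed.

Lemma measurable_Lspace_powRZ u (c : R) :
  measurable_fun [set: T] (fun x => (c * `|u x| `^ p)%:E).
Proof.
under eq_fun do rewrite EFinM.
exact: measurable_funeM (measurable_Lspace_powR u).
Qed.

Lemma integral_Lspace_normZ u c : 0 <= c ->
  (\int[mu]_x (c * `|u x| `^ p)%:E = (c * `|u| `^ p)%:E)%E.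
Proof.
move=> c0; under eq_integral do rewrite EFinM.
rewrite ge0_integralZl_EFin//; first by rewrite integral_Lspace_norm.
exact: measurable_Lspace_powR.
Qed.

End one_exponent.

Context (p : R) (p1 : (1 <= p%:E)%E).
Local Notation L2 := (LspaceType mu (ler1n R 2 : (1 <= 2%:E)%E)).
Implicit Types (u v : LspaceType mu p1) (f g : L2).

Lemma Lspace_mazur_norm u f : 0 < p ->
  (f : T -> R) = mazur_fun p (u : T -> R) %[ae mu] -> `|f| ^+ 2 = `|u| `^ p.
Proof.
move=> p0 fu; apply: EFin_inj; rewrite -powR_mulrn// -!integral_Lspace_norm.
apply: ge0_ae_eq_integral => //.
- exact: measurable_Lspace_powR.
- exact: measurable_Lspace_powR.
apply: filterS fu => x /(_ I) fx _.
by rewrite fx powR_mulrn// sqr_normr_spow// gt_eqF.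
Qed.

(** The Mazur map is [p]-Lipschitz on the unit ball; [f] and [g] are its values
at [u] and [v]. *)
Lemma Lspace_mazur_dist_le u v f g : 2 < p -> `|u| <= 1 -> `|v| <= 1 ->
  (f : T -> R) = mazur_fun p (u : T -> R) %[ae mu] ->
  (g : T -> R) = mazur_fun p (v : T -> R) %[ae mu] ->
  `|f - g| <= p * `|u - v|.
Proof.
move=> p2 u1 v1 hf hg; have p0 : 0 < p by rewrite (lt_trans _ p2).
(* The pointwise estimate divides by the distance [D] from [u] to [v]. *)
have [uv|uv] := eqVneq u v.
  have -> : f = g.
    by apply: LspaceP; apply: (ae_eq_trans hf); rewrite uv; exact: ae_eq_sym.
  by rewrite uv !subrr !normr0 mulr0.
have D0 : 0 < `|u - v| by rewrite normr_gt0 subr_eq0.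
set D := `|u - v| in D0 *; set c := (p / 2 * D) ^+ 2.
have c0 : 0 <= c by exact: sqr_ge0.
have d0 : 0 <= c * D^-1 `^ p by rewrite mulr_ge0 ?powR_ge0.
have le1 (w : LspaceType mu p1) : `|w| <= 1 -> `|w| `^ p <= 1.
  move=> w1; have <- : 1 `^ p = 1 :> R by rewrite powR1.
  by apply: ge0_ler_powR; rewrite ?nnegrE// ltW.
suff : `|f - g| ^+ 2 <=
    c * `|u| `^ p + c * `|v| `^ p + c * D^-1 `^ p * `|u - v| `^ p.
  have -> : c * D^-1 `^ p * `|u - v| `^ p = c.
    by rewrite -mulrA -powRM ?invr_ge0 ?(ltW D0)// mulVf ?gt_eqF// powR1 mulr1.
  have := le1 _ u1; have := le1 _ v1 => hv hu h.
  rewrite -ler_sqr ?nnegrE ?mulr_ge0 ?(ltW p0) ?(ltW D0)//.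
  (* The integrated estimate gives [3 * c], and [c = (p / 2 * D) ^+ 2]. *)
  have -> : (p * D) ^+ 2 = 4 * c by rewrite /c; field.
  by apply: (le_trans h); nra.
rewrite -[`|f - g| ^+ 2]powR_mulrn// -lee_fin.
rewrite [leRHS]EFinD [X in (_ <= X + _)%E]EFinD.
rewrite -integral_Lspace_norm -!integral_Lspace_normZ//.
have nneg (w : LspaceType mu p1) (k : R) : 0 <= k ->
    forall x, [set: T] x -> (0 <= (k * `|w x| `^ p)%:E)%E.
  by move=> k0 x _; rewrite lee_fin mulr_ge0// powR_ge0.
have nnegD x : [set: T] x -> (0 <= (c * `|u x| `^ p)%:E + (c * `|v x| `^ p)%:E)%E.
  by move=> _; rewrite adde_ge0// nneg.
have mD : measurable_fun [set: T]
    (fun x => (c * `|u x| `^ p)%:E + (c * `|v x| `^ p)%:E)%E.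
  by apply: emeasurable_funD; exact: measurable_Lspace_powRZ.
rewrite -ge0_integralD//; [|exact: nneg|exact: measurable_Lspace_powRZ..|
                            exact: nneg|exact: measurable_Lspace_powRZ].
rewrite -ge0_integralD//; [|exact: nneg|exact: measurable_Lspace_powRZ].
apply: ae_ge0_le_integral => //.
- exact: measurable_Lspace_powR.
- by move=> x _; rewrite adde_ge0 ?nnegD// nneg.
- by apply: emeasurable_funD => //; exact: measurable_Lspace_powRZ.
have hd := LspaceB_ae u v; have hfg := LspaceB_ae f g.
apply: filterS2 (filterI hf hg) (filterI hd hfg).
move=> x [/(_ I) fx /(_ I) gx] [-> ->] _; rewrite -!EFinD lee_fin fx gx.
rewrite powR_mulrn//.
by have := sqr_spow_dist_le (u x) (v x) p2 D0; rewrite -/c !mulrDr mulrA.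
Qed.

Lemma Lspace_dist_scale_le u v f g : 2 <= p ->
  (f : T -> R) = mazur_fun p (u : T -> R) %[ae mu] ->
  (g : T -> R) = mazur_fun p (v : T -> R) %[ae mu] ->
  `|v - p^-1 *: u| `^ p <= 2 / 3 * `|v| `^ p + 16 * `|g - f| ^+ 2.
Proof.
move=> p2 hf hg; rewrite -[_ ^+ 2]powR_mulrn// -lee_fin EFinD.
rewrite -integral_Lspace_norm -!integral_Lspace_normZ//.
rewrite -ge0_integralD//; [|exact: measurable_Lspace_powRZ..].
apply: ae_ge0_le_integral => //.
- exact: measurable_Lspace_powR.
- by move=> x _; rewrite adde_ge0 ?lee_fin ?mulr_ge0 ?powR_ge0.
- by apply: emeasurable_funD; exact: measurable_Lspace_powRZ.
have hd := LspaceB_ae v (p^-1 *: u); have hz := LspaceZ_ae p^-1 u.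
have hgf := LspaceB_ae g f.
apply: filterS2 (filterI hf hg) (filterI hd (filterI hz hgf)).
move=> x [/(_ I) fx /(_ I) gx] [-> [-> ->]] _; rewrite -EFinD lee_fin fx gx.
rewrite powR_mulrn//.
exact: powR_dist_scale_le.
Qed.

End Lspace_norm.

(** * The Mazur map on the unit interval *)

Section mazur_map.
Context {R : realType}.
Context (p : R) (p1 : 1 <= p) (p2 : 2 < p).
Local Notation mu := (leb01 R).
Local Notation unit_ball := (closed_ball_ Num.norm (0 : Lp p1) 1).
Local Notation M := (@mazur R p p1).
Implicit Types u v : Lp p1.

Let p0 : 0 < p. Proof. by rewrite (lt_trans _ p2). Qed.

Lemma norm_mazur u : `|mazur u| ^+ 2 = `|u| `^ p.
Proof. exact: Lspace_mazur_norm (mazurE u). Qed.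

Lemma unit_ballE u : unit_ball u <-> `|u| <= 1.
Proof. by rewrite /closed_ball_ /= sub0r normrN. Qed.

Lemma mazur_lipschitz : p.-lipschitz_unit_ball M.
Proof.
move=> [u v] [/= /unit_ballE u1 /unit_ballE v1].
exact: Lspace_mazur_dist_le p2 u1 v1 (mazurE u) (mazurE v).
Qed.

Lemma leb01_setT : mu setT = 1%E.
Proof.
by rewrite /= /mrestr setTI lebesgue_measure_itv/= lte01 sube0.
Qed.

Lemma cst1_Lnorm : 'N[mu]_p%:E[EFin \o cst 1%R]%E = 1%E.
Proof.
by rewrite (Lnorm_cst1 mu p) leb01_setT poweR1r.
Qed.

Lemma cst1_Lfun : (cst 1 : measurableTypeR R -> R) \in Lfun mu p%:E.
Proof.
apply/andP; split; rewrite inE/=; first exact: measurable_cst.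
by rewrite /finite_norm cst1_Lnorm ltry.
Qed.

Lemma exists_norm1 : exists u : Lp p1, `|u| = 1.
Proof.
exists (Lclass (Lfun_Sub (p1 : (1 <= p%:E)%E) cst1_Lfun)).
by rewrite [LHS]Lspace_normE [X in fine X]cst1_Lnorm.
Qed.

Lemma lipschitz_constant_mazur : 1 <= lipschitz_constant unit_ball M <= p.
Proof.
have pS : [set k : R | 0 <= k /\ k.-lipschitz_unit_ball M] p.
  by split; [exact: ltW | exact: mazur_lipschitz].
apply/andP; split; last by apply: ge_inf => //; exists 0 => k [].
apply: lb_le_inf; first by exists p.
(* The images of 0 and of a unit vector are at distance 1. *)
move=> k [k0 kL]; have [u u1] := exists_norm1.
have M0 : M 0 = 0.
  apply/eqP; rewrite -normr_eq0 -sqrf_eq0 norm_mazur normr0 powR0//.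
  by rewrite gt_eqF.
have Mu : `|M u| = 1.
  by apply/eqP; rewrite -sqrp_eq1// norm_mazur u1 powR1.
have /(_ (u, 0)) /= := kL; rewrite M0 !subr0 Mu u1 mulr1; apply.
by split; apply/unit_ballE => //=; rewrite ?u1 ?normr0.
Qed.

(** The conclusion of the theorem in terms of the map before normalization, for
any radius [b] that makes the constants fit. *)
Lemma dist_scale_le_of_mazur u v (b : R) : 0 <= b ->
  2 / 3 * (1 + b) ^+ 2 + 16 * b ^+ 2 <= 5 / 7 ->
  `|u| <= 1 -> `|mazur u - mazur v| <= b ->
  `|p^-1 *: u - v| <= 1 - (4 * p)^-1.
Proof.
move=> b0 hb u1 uv.
have Mu : `|mazur u| <= 1.
  rewrite -(@ler_sqr _ _ 1) ?nnegrE// norm_mazur expr1n.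
  have <- : 1 `^ p = 1 :> R by rewrite powR1.
  by rewrite ge0_ler_powR ?nnegrE// ltW.
have Mv : `|v| `^ p <= (1 + b) ^+ 2.
  rewrite -norm_mazur ler_sqr ?nnegrE ?addr_ge0//.
  have -> : mazur v = mazur u - (mazur u - mazur v) by rewrite opprB addrC subrK.
  by apply: le_trans (ler_normB _ _) _; rewrite lerD.
have r0 : 0 <= 1 - (4 * p)^-1.
  by rewrite subr_ge0 invf_le1 ?mulr_gt0// (le_trans p1)// ler_peMl ?ler1n// ltW.
rewrite distrC leNgt; apply/negP => /(gt0_ltr_powR p0) => /(_ _ _).
rewrite !nnegrE => /(_ r0 (normr_ge0 _)); apply/negP; rewrite -leNgt.
apply: le_trans (powR_shrink_ge (ltW p2)); apply: le_trans hb.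
apply: le_trans (Lspace_dist_scale_le (ltW p2) (mazurE u) (mazurE v)) _.
rewrite lerD// ler_wpM2l// ler_sqr ?nnegrE// distrC; exact: uv.
Qed.

End mazur_map.

Theorem mainTheorem10 (R : realType) :
  exists2 beta : R, 0 < beta &
    forall (p : R) (p2 : 2 < p) (phi : Lp (gt2_ge1 p2)),
      closed_ball_ Num.norm 0 1 phi ->
      @normalized_mazur R p (gt2_ge1 p2) @^-1`
          closed_ball_ Num.norm (normalized_mazur phi) (beta / p)
        `<=` closed_ball_ Num.norm (p^-1 *: phi) (1 - (4 * p)^-1).
Proof.
exists (1 / 100) => [|p p2 phi /unit_ballE phi1 psi]; first by rewrite divr_gt0.
have p0 : 0 < p by rewrite (lt_trans _ p2).
rewrite /closed_ball_ /= /normalized_mazur -scalerBr normrZ.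
have /andP[] := lipschitz_constant_mazur (gt2_ge1 p2) p2.
set L := lipschitz_constant _ _ => L1 Lp.
have L0 : 0 < L by rewrite (lt_le_trans _ L1).
rewrite ger0_norm ?invr_ge0 ?(ltW L0)// ler_pdivrMl// => close.
apply: (dist_scale_le_of_mazur p2 (b := 1 / 100)) => //; first by lra.
apply: le_trans close _; rewrite mulrCA ger_pMr ?divr_gt0//.
by rewrite ler_pdivrMr// mul1r.
Qed.
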